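(* Let $A$ be an alternative Cartan $*$-algebra with $\mathbb{S}_A\neq\varnothing$, and let $s_A:=|\{K\in\mathcal{P}(n): e_K\in\mathbb{S}_A\}|$. If $s_A\ge 6$, then $$\mathcal{R}(A)\le\frac{127}{418}\dim(A)\quad(\simeq 0.30382775\,\dim(A)),$$ where $\mathcal{R}(A)$ is the reconstructing number of $A$.
   Context: **Cartan $*$-algebras.** Let $n\ge 1$, let $\mathcal{P}(n)$ be the power set of $\{1,\dots,n\}$ and $K\triangle H:=(K\setminus H)\cup(H\setminus K)$. A Cartan algebra is a real (not necessarily associative) algebra $A$ with a fixed real vector basis $\{e_K\}_{K\in\mathcal{P}(n)}$ and a function $\sigma:\mathcal{P}(n)\times\mathcal{P}(n)\to\{-1,1\}$ such that $\sigma(K,\varnothing)=\sigma(\varnothing,K)=1$ and $e_Ke_H=\sigma(K,H)e_{K\triangle H}$ for all $K,H$. Thus $e_\varnothing=1$ is the unity, and $\mathbb{R}$ is identified with $\mathbb{R}1\subset A$. $A$ is alternative if $x(xy)=x^2y$ and $(xy)y=xy^2$ for all $x,y$. A $*$-involution is a real linear map $x\mapsto x^c$ with $(x^c)^c=x$, $(xy)^c=y^cx^c$ and $x^c=x$ for $x\in\mathbb{R}$. A Cartan $*$-algebra is a Cartan algebra endowed with a $*$-involution such that $e_{\{k\}}^c\in\{e_{\{k\}},-e_{\{k\}}\}$ for $k=1,\dots,n$. Set $\mathbb{S}_A:=\{J\in A: J^c=-J,\ J^2=-1\}$. **Slice regular functions.** For $J\in\mathbb{S}_A$ let $\mathbb{C}_J:=\{\alpha+\beta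 J:\alpha,\beta\in\mathbb{R}\}$, and let $Q_A:=\bigcup_{J\in\mathbb{S}_A}\mathbb{C}_J$. For $D\subset\mathbb{C}$ non-empty, open and invariant under complex conjugation, let $\Omega_D:=\{\alpha+\beta J:\alpha,\beta\in\mathbb{R},\ \alpha+i\beta\in D,\ J\in\mathbb{S}_A\}\subset Q_A$ (an open circular set). It is a circular slice domain if moreover $D$ is connected and $D\cap\mathbb{R}\ne\varnothing$. A stem function on $D$ is $F=F_1+\iota F_2:D\to A\otimes_{\mathbb{R}}\mathbb{C}$ ($\iota$ the imaginary unit of the second factor, $F_1,F_2:D\to A$) with $F_1(\bar z)=F_1(z)$, $F_2(\bar z)=-F_2(z)$. It induces the slice function $f=\mathcal{I}(F):\Omega_D\to A$, $f(\alpha+\beta J)=F_1(\alpha+i\beta)+JF_2(\alpha+i\beta)$. $f$ is slice regular if $F$ is of class $C^1$ and $\frac{\partial F}{\partial\alpha}+\iota\frac{\partial F}{\partial\beta}=0$. The real components of $f$ are the functions $f_K:\Omega_D\to\mathbb{R}$ with $f=\sum_K f_Ke_K$. **Reconstructing number.** $\mathcal{R}(A)$ is the minimum integer $\ell$ for which there is a subset $\mathcal{K}\subset\mathcal{P}(n)$ of cardinality $\ell$ such that, for each circular slice domain $\Omega\subset Q_A$ and each slice regular $f:\Omega\to A$, if $f_K$ is constant for each $K\in\mathcal{K}$, then $f$ is constant. *)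

(* Defs.v *)
From mathcomp Require Import all_boot all_order all_algebra.
From mathcomp Require Import all_classical all_reals all_analysis.

Set Implicit Arguments.
Unset Strict Implicit.
Unset Printing Implicit Defensive.

Import Order.TTheory GRing.Theory Num.Theory.
Import numFieldTopology.Exports numFieldNormedType.Exports.

Local Open Scope classical_set_scope.
Local Open Scope ring_scope.

(* The index set {1, ..., n} is rendered by 'I_n = {0, ..., n - 1}. *)
Definition symdiff (n : nat) (K H : {set 'I_n}) : {set 'I_n} :=
  ((K :\: H) :|: (H :\: K))%SET.

Definition cartan_tuple (R : realType) (n : nat) (V : vectType R)
    (ce : {set 'I_n} -> V) : #|{: {set 'I_n}}|.-tuple V :=
  [tuple ce (enum_val i) | i < #|{: {set 'I_n}}|].

(* The product is not assumed associative, so the MathComp ring structures do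
   not apply: it is a bare bilinear map on a finite-dimensional real space. *)
Record cartanAlgebra (R : realType) (n : nat) := CartanAlgebra {
  carrier :> vectType R;
  cmul : {bilinear carrier -> carrier -> carrier};
  ce : {set 'I_n} -> carrier;
  csigma : {set 'I_n} -> {set 'I_n} -> R;
  ce_basis : basis_of fullv (cartan_tuple ce);
  csigma_pm1 : forall K H, csigma K H = -1 \/ csigma K H = 1;
  csigma_l0 : forall K, csigma K finset.set0 = 1;
  csigma_0l : forall K, csigma finset.set0 K = 1;
  cmul_e : forall K H, cmul (ce K) (ce H) = csigma K H *: ce (symdiff K H)
}.

Definition cunity (R : realType) (n : nat) (A : cartanAlgebra R n) : A :=
  ce A finset.set0.

Definition component (R : realType) (n : nat) (A : cartanAlgebra R n)
    (K : {set 'I_n}) (x : A) : R :=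
  coord (cartan_tuple (ce A)) (enum_rank K) x.

Definition alternative (R : realType) (n : nat) (A : cartanAlgebra R n) :=
  forall x y : A, cmul A x (cmul A x y) = cmul A (cmul A x x) y /\
                  cmul A (cmul A x y) y = cmul A x (cmul A y y).

Record cartanStarAlgebra (R : realType) (n : nat) := CartanStarAlgebra {
  cartan_base :> cartanAlgebra R n;
  cstar : {linear cartan_base -> cartan_base};
  cstarK : forall x, cstar (cstar x) = x;
  cstarM : forall x y,
    cstar (cmul cartan_base x y) = cmul cartan_base (cstar y) (cstar x);
  cstar_real : forall a : R,
    cstar (a *: cunity cartan_base) = a *: cunity cartan_base;
  cstar_gen : forall k : 'I_n,
    cstar (ce cartan_base (finset.set1 k)) = ce cartan_base (finset.set1 k) \/
    cstar (ce cartan_base (finset.set1 k)) = - ce cartan_base (finset.set1 k)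
}.

Section SliceFunctions.
Context (R : realType) (n : nat) (A : cartanStarAlgebra R n).

Definition SA : set A :=
  [set J | cstar A J = - J /\ cmul A J J = - cunity A].

Definition sA : nat := #|[pred K : {set 'I_n} | ce A K \in SA]|.

(* The complex number alpha + i beta is the pair (alpha, beta). *)
Definition cconj (z : R^o * R^o) : R^o * R^o := (z.1, - z.2).

Definition Omega (D : set (R^o * R^o)) : set A :=
  [set x | exists alpha beta J,
     [/\ D (alpha, beta), SA J & x = alpha *: cunity A + beta *: J]].

Definition admissible (D : set (R^o * R^o)) : Prop :=
  [/\ D !=set0, open D & forall z, D z -> D (cconj z)].

Definition slice_domain (D : set (R^o * R^o)) : Prop :=
  [/\ admissible D, connected D & exists alpha : R, D (alpha, 0)].

(* The tensor product of A with the complex numbers is A * A, the pair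
   (a, b) standing for a + iota b. *)
Definition iota_mul (w : A * A) : A * A := (- w.2, w.1).

Definition is_stem (D : set (R^o * R^o)) (F : R^o * R^o -> A * A) : Prop :=
  forall z, D z -> (F (cconj z)).1 = (F z).1 /\ (F (cconj z)).2 = - (F z).2.

(* A function with values in A is differentiated through its real components;
   v = (1, 0) and v = (0, 1) give the partial derivatives in alpha and beta. *)
Definition partialA (v : R^o * R^o) (g : R^o * R^o -> A) (z : R^o * R^o) : A :=
  \sum_(K : {set 'I_n})
     ('D_v (fun w => component K (g w) : R^o) z : R) *: ce A K.

Definition partialAC (v : R^o * R^o) (F : R^o * R^o -> A * A)
    (z : R^o * R^o) : A * A :=
  (partialA v (fun w => (F w).1) z, partialA v (fun w => (F w).2) z).

Definition C1_real (D : set (R^o * R^o)) (g : R^o * R^o -> R^o) : Prop :=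
  forall v, v = (1, 0) \/ v = (0, 1) -> forall z, D z ->
    derivable g z v /\ {for z, continuous ('D_v g)}.

Definition C1_stem (D : set (R^o * R^o)) (F : R^o * R^o -> A * A) : Prop :=
  forall K : {set 'I_n},
    C1_real D (fun z => component K (F z).1) /\
    C1_real D (fun z => component K (F z).2).

(* A function on Omega D is the restriction of a total function f : A -> A. *)
Definition induced_by (D : set (R^o * R^o)) (F : R^o * R^o -> A * A)
    (f : A -> A) : Prop :=
  forall alpha beta J, D (alpha, beta) -> SA J ->
    f (alpha *: cunity A + beta *: J) =
      (F (alpha, beta)).1 + cmul A J (F (alpha, beta)).2.

Definition slice_regular (D : set (R^o * R^o)) (f : A -> A) : Prop :=
  exists F : R^o * R^o -> A * A,
    [/\ is_stem D F, induced_by D F f, C1_stem D F &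
        forall z, D z ->
          partialAC (1, 0) F z + iota_mul (partialAC (0, 1) F z) = 0].

Definition constant_on (T : Type) (X : set A) (g : A -> T) : Prop :=
  exists c : T, forall x, X x -> g x = c.

(* A circular slice domain is Omega D with D a slice_domain; since all notions
   are induced by D, the domains are quantified through D, and the inclusion of
   Omega D in the quadratic cone (the union of the planes C_J) is automatic. *)
Definition reconstructing (KK : {set {set 'I_n}}) : Prop :=
  forall D, slice_domain D -> forall f, slice_regular D f ->
    (forall K, K \in KK -> constant_on (Omega D) (fun x => component K (f x))) ->
    constant_on (Omega D) f.

Lemma component_sum (x : A) : x = \sum_(K : {set 'I_n}) component K x *: ce A K.
Proof.
rewrite {1}(coord_basis (ce_basis A) (memvf x)).
rewrite (reindex (@enum_rank {set 'I_n})) /=; last first.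
  by apply: onW_bij; exact: enum_rank_bij.
apply: eq_bigr => K _; congr (_ *: _).
transitivity (tnth (cartan_tuple (ce A)) (enum_rank K)).
  by rewrite (tnth_nth 0).
by rewrite tnth_mktuple enum_rankK.
Qed.

Lemma reconstructing_setT : reconstructing [set: {set 'I_n}]%SET.
Proof.
move=> D _ f _ cst.
have /choice [c cP] : forall K : {set 'I_n}, exists cK : R,
    forall x, Omega D x -> component K (f x) = cK.
  by move=> K; apply: cst; rewrite finset.inE.
exists (\sum_(K : {set 'I_n}) c K *: ce A K) => x Dx.
by rewrite [LHS]component_sum; apply: eq_bigr => K _; rewrite cP.
Qed.

Lemma reconstructing_card : exists l : nat,
  `[< exists KK : {set {set 'I_n}}, #|KK| = l /\ reconstructing KK >].
Proof.
exists #|[set: {set 'I_n}]%SET|; apply/asboolP.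
by exists [set: {set 'I_n}]%SET; split => //; exact: reconstructing_setT.
Qed.

Definition reconstructing_number : nat := ex_minn reconstructing_card.

End SliceFunctions.

Arguments SA {R n} A.

(* Main.v *)
Require Import Defs.
From mathcomp Require Import all_boot all_order all_algebra.
From mathcomp Require Import all_classical all_reals all_analysis.
From mathcomp Require Import lra.

Import Order.TTheory GRing.Theory Num.Theory.
Import numFieldTopology.Exports numFieldNormedType.Exports.

(** The bound holds with 1/4 in place of 127/418, from two facts.

    Analysis ([dominating_reconstructing]).  Let [f] be induced by the
    holomorphic stem function [F = F1 + iota F2], and suppose that [f_K] is
    constant.  Comparing the values of [f] at [alpha + beta J] and at
    [alpha - beta J] separates the stem function: [(F1)_K] is constant and
    [(J F2)_K = 0] for every [J] in [S_A].  The first conclusion and the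
    Cauchy-Riemann equations make [(F2)_K] constant, hence zero since [F2]
    vanishes on the real axis, which the connected set [D] meets.  The second
    one, for [J = e_L], says that [(F2)_H = 0] for [H = K + L], where [+] is the
    symmetric difference, because [e_L] permutes the basis up to sign.
    So if every [H] either lies in a family [KK] or is carried into it by some
    [L] with [e_L] in [S_A], that is, if [KK] dominates the Cayley graph of
    (P(n), symmetric difference) with these [L] as connection set, then [F2]
    vanishes; by the Cauchy-Riemann equations [F1] is constant, and so is [f].

    Combinatorics ([quarter_covering]).  A Cayley graph of an elementary abelian
    2-group whose connection set has three distinct nonzero elements [a], [b],
    [c] is dominated by a subgroup [N] of index 4: it suffices that [a], [b] and
    [c] represent the three nontrivial cosets of [N].  Such an [N] is a maximal
    subgroup among those that contain [a + b + c] and avoid [a], [b], [a + b]. *)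

(** * Index-four subgroups of the power set *)

Section Covering.
Variable n : nat.
Implicit Types K H L : {set 'I_n}.
Local Notation "0" := (@finset.set0 'I_n).
Local Infix "+" := (@symdiff n).

Lemma symdiffE K H i : (i \in K + H) = (i \in K) (+) (i \in H).
Proof. by rewrite !inE; case: (i \in K); case: (i \in H). Qed.

Lemma symdiffC : commutative (@symdiff n).
Proof. by move=> K H; apply/setP => i; rewrite !symdiffE addbC. Qed.

Lemma symdiffA : associative (@symdiff n).
Proof. by move=> K H L; apply/setP => i; rewrite !symdiffE addbA. Qed.

Lemma symdiff0s : left_id 0 (@symdiff n).
Proof. by move=> K; apply/setP => i; rewrite symdiffE inE. Qed.

Lemma symdiffss K : K + K = 0.
Proof. by apply/setP => i; rewrite symdiffE inE addbb. Qed.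

Lemma symdiffKs K : involutive (symdiff K).
Proof. by move=> H; rewrite symdiffA symdiffss symdiff0s. Qed.

(** Being a subgroup: opposites are automatic, as every element is its own.  A
    boolean form is what makes maximal subgroups available. *)
Definition symdiff_closed (N : {set {set 'I_n}}) :=
  (0 \in N) && [forall K in N, [forall H in N, K + H \in N]].

Lemma symdiff_closedP (N : {set {set 'I_n}}) :
  reflect (0 \in N /\ forall K H, K \in N -> H \in N -> K + H \in N)
          (symdiff_closed N).
Proof.
apply: (iffP andP) => [[N0 /'forall_implyP NP]|[N0 NP]]; split => //.
- by move=> K H KN HN; move: (NP K KN) => /'forall_implyP; apply.
- by apply/'forall_implyP => K KN; apply/'forall_implyP => H HN; exact: NP.
Qed.

Lemma closed_pair K : symdiff_closed [set 0; K]%SET.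
Proof.
apply/symdiff_closedP; split => [|X Y]; rewrite !inE ?eqxx//.
by move=> /orP[]/eqP-> /orP[]/eqP->; rewrite ?symdiffss ?symdiff0s;
  rewrite 1?symdiffC ?symdiff0s eqxx ?orbT.
Qed.

(** The subgroup generated by [K] and [N], when [N] is a subgroup. *)
Definition adjoin (K : {set 'I_n}) (N : {set {set 'I_n}}) : {set {set 'I_n}} :=
  (N :|: [set symdiff K H | H in N])%SET.

Lemma mem_adjoin K N H : (H \in adjoin K N) = (H \in N) || (K + H \in N).
Proof.
rewrite inE; congr (_ || _); apply/imsetP/idP => [[X XN ->]|XN].
  by rewrite symdiffKs.
by exists (K + H); rewrite ?symdiffKs.
Qed.

Lemma adjoin_closed K N : symdiff_closed N -> symdiff_closed (adjoin K N).
Proof.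
move=> /symdiff_closedP[N0 ND]; apply/symdiff_closedP; split=> [|X Y].
  by rewrite mem_adjoin N0.
rewrite !mem_adjoin => /orP[XN|XN] /orP[YN|YN]; apply/orP.
- by left; apply: ND.
- by right; rewrite symdiffA (symdiffC K) -symdiffA; apply: ND.
- by right; rewrite symdiffA; apply: ND.
- left; rewrite -(symdiffKs K Y) symdiffA (symdiffC X K); exact: ND.
Qed.

Lemma card_adjoin K N : symdiff_closed N -> K \notin N ->
  #|adjoin K N| = (2 * #|N|)%N.
Proof.
move=> /symdiff_closedP[N0 ND] KN; rewrite cardsU.
rewrite (_ : (N :&: _)%SET = finset.set0) ?cards0 ?subn0.
  by rewrite card_imset ?mul2n ?addnn//; exact: can_inj (symdiffKs K).
apply/setP => X; rewrite !inE; apply/negP => /andP[XN /imsetP[Y YN XE]].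
move/negP: KN; apply.
have -> : K = X + Y by rewrite XE -symdiffA symdiffss symdiffC symdiff0s.
exact: ND.
Qed.

(** Take [N] maximal among the subgroups that contain [a + b + c] and avoid [a],
    [b] and [a + b].  The last condition says that the cosets of [0], [a], [b],
    [a + b] are distinct; by maximality they exhaust the group, as adjoining any
    further [H] to [N] captures one of [a], [b], [a + b].  The coset of [a + b]
    is that of [c].  The case [c = a + b] is the one in which the subgroup
    generated by [a + b + c] is trivial. *)
Lemma quarter_covering (a b c : {set 'I_n}) :
  a != 0 -> b != 0 -> c != 0 -> a != b -> b != c -> c != a ->
  exists N : {set {set 'I_n}}, (4 * #|N| = 2 ^ n)%N /\
    forall H, [|| H \in N, a + H \in N, b + H \in N | c + H \in N].
Proof.
move=> a0 b0 c0 ab bc ca.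
pose P N := [&& symdiff_closed N, a \notin N, b \notin N & a + b \notin N].
(* [a + b + c] is none of [a], [b], [a + b], as [b != c], [c != a], [c != 0];
   and [a + b != 0], as [a != b]. *)
have P0 : P [set 0; a + b + c]%SET.
  rewrite /P closed_pair !inE !negb_or a0 b0 /=.
  by apply/and4P; split; [move: bc|move: ca|move: ab|move: c0];
    apply: contra => /eqP/setP E; apply/eqP/setP => i; move: (E i);
    rewrite !symdiffE ?inE; do ?case: (_ \in _).
have [N /maxsetP[/and4P[NC aN bN abN] Nmax] sN] := maxset_exists P0.
have /symdiff_closedP[N0 ND] := NC.
have NcE : a + b + c \in N by apply: (fintype.subsetP sN); rewrite !inE eqxx orbT.
(* The index of [N] is computed along the chain [N], [N + <a>], [N + <a, b>]. *)
have bM : b \notin adjoin a N by rewrite mem_adjoin negb_or bN.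
have cover H : H \in adjoin b (adjoin a N).
  have [HN|HN] := boolP (H \in N); first by rewrite !mem_adjoin HN.
  have : ~~ P (adjoin H N).
    apply: contra HN => /Nmax NE; rewrite -NE ?mem_adjoin ?symdiffss ?N0 ?orbT//.
    exact: finset.subsetUl.
  rewrite /P adjoin_closed// !mem_adjoin (negbTE aN) (negbTE bN) (negbTE abN) /=.
  rewrite -!negb_or negbK !(symdiffC _ H) !(symdiffC H) -symdiffA.
  by case/or3P => ->; rewrite ?orbT.
exists N; split.
  transitivity #|adjoin b (adjoin a N)|.
    by rewrite !card_adjoin ?adjoin_closed// mulnA.
  have -> : adjoin b (adjoin a N) = [set: {set 'I_n}]%SET.
    by apply/setP => H; rewrite cover inE.
  by rewrite -powersetT card_powerset cardsT card_ord.
move=> H; have := cover H; rewrite !mem_adjoin => /orP[/orP[]->|/orP[]h].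
- by [].
- by rewrite orbT.
- by rewrite h !orbT.
(* [c + H = (a + b + c) + (a + (b + H))]. *)
- apply/or4P; apply: Or44; have := ND _ _ NcE h; congr (_ \in N).
  by apply/setP => i; rewrite !symdiffE; do ?case: (_ \in _).
Qed.
End Covering.
(** * Functions with vanishing partial derivatives *)

Local Open Scope classical_set_scope.
Local Open Scope ring_scope.

Section Calculus.
Variable R : realType.

Lemma is_derive0_ball_cst (h : R -> R) (c e x : R) :
  (forall t, ball c e t -> is_derive t 1 h 0) -> ball c e x -> h x = h c.
Proof.
move=> h0; rewrite -ball_normE /= ltr_norml => /andP[lt1 lt2].
have aux a b : a <= b -> c - e < a -> b < c + e -> h a = h b.
  move=> ab ca be.
  have D t : t \in `[a, b] -> is_derive t 1 h 0.
    rewrite in_itv /= => /andP[at_ tb]; apply: h0.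
    by rewrite -ball_normE /= ltr_norml; apply/andP; split; lra.
  have hc : {within `[a, b], continuous h}.
    by apply: derivable_within_continuous => t /D[].
  have hd t : t \in `]a, b[ -> is_derive t 1 h 0.
    by move=> tab; apply: D; exact: subset_itv_oo_cc.
  have [d _] := @MVT_segment R h (fun=> 0) a b ab hd hc.
  by rewrite mul0r => /subr0_eq->.
by have [xc|/ltW cx] := leP x c; [|apply/esym]; apply: aux => //; lra.
Qed.

(** Balls of the product are squares, so any point of a ball is joined to the
    centre inside the ball by a horizontal and a vertical segment, along which
    the mean value theorem applies. *)
Lemma zero_partials_locally_cst (D : set (R^o * R^o)) (g : R^o * R^o -> R^o) :
  open D ->
  (forall z, D z -> is_derive z (1, 0) g 0 /\ is_derive z (0, 1) g 0) ->
  forall z, D z -> \forall w \near z, g w = g z.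
Proof.
move=> oD g0 [z1 z2] Dz.
have /nbhs_ballP[e /= e0 eD] : nbhs (z1, z2) D by exact: open_nbhs_nbhs.
apply/nbhs_ballP; exists e => //= -[w1 w2] [/= B1 B2].
transitivity (g (w1, z2)).
  apply: (@is_derive0_ball_cst (fun t => g (w1, t)) z2 e) => // t Bt.
  have [_ [dg vg]] := g0 (w1, t) (eD (w1, t) (conj B1 Bt)).
  (* The difference quotients of the restriction to the vertical line are those
     of [g] in the direction (0, 1). *)
  have E : (fun h : R => h^-1 *: (((fun t => g (w1, t)) \o shift t) (h *: 1) - g (w1, t)))
     = (fun h : R => h^-1 *: ((g \o shift (w1, t)) (h *: (0, 1)) - g (w1, t))).
    by apply/funext => h /=; congr (_ *: (g _ - _)); congr pair;
      rewrite /= ?scaler0 ?add0r.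
  by split; [rewrite /derivable E|rewrite /derive E].
apply: (@is_derive0_ball_cst (fun t => g (t, z2)) z1 e) => // t Bt.
have [[dg vg] _] := g0 (t, z2) (eD (t, z2) (conj Bt (ballxx z2 e0))).
have E : (fun h : R => h^-1 *: (((fun t => g (t, z2)) \o shift t) (h *: 1) - g (t, z2)))
   = (fun h : R => h^-1 *: ((g \o shift (t, z2)) (h *: (1, 0)) - g (t, z2))).
  by apply/funext => h /=; congr (_ *: (g _ - _)); congr pair;
    rewrite /= ?scaler0 ?add0r.
by split; [rewrite /derivable E|rewrite /derive E].
Qed.

Lemma zero_partials_cst (D : set (R^o * R^o)) (g : R^o * R^o -> R^o) :
  open D -> connected D ->
  (forall z, D z -> is_derive z (1, 0) g 0 /\ is_derive z (0, 1) g 0) ->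
  forall z w, D z -> D w -> g z = g w.
Proof.
move=> oD cD g0 z w Dz Dw.
have loc := zero_partials_locally_cst _ _ oD g0.
(* The set where [g] equals [g z] and its complement in [D] are both open, so that
   connectedness applies. *)
pose U (b : bool) := [set x | D x /\ (g x == g z) = b].
have oU b : open (U b).
  rewrite openE => x [Dx gx]; apply: filterS2 (loc x Dx) (open_nbhs_nbhs (conj oD Dx)).
  by move=> y gy Dy; split => //; rewrite gy.
suff UD : U true = D by apply/esym/eqP; have [] : U true w by rewrite UD.
apply: cD.
- by exists z; split; rewrite ?eqxx.
- by exists (U true) => //; rewrite setIidr// => x [].
- exists (~` U false); first exact: open_closedC.
  apply/seteqP; split=> x [Dx gx]; split=> //; first by case; rewrite gx.
  by apply: contra_notT gx => /negbTE; split.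
Qed.
End Calculus.
(** * Real components in a Cartan algebra *)

Section Components.
Variables (R : realType) (n : nat) (A : cartanStarAlgebra R n).
Implicit Types (K H L : {set 'I_n}) (x y : A).

Lemma componentD K x y : component K (x + y) = component K x + component K y.
Proof. exact: linearD. Qed.

Lemma componentN K x : component K (- x) = - component K x.
Proof. exact: linearN. Qed.

Lemma componentZ K k x : component K (k *: x) = k * component K x.
Proof. exact: linearZ. Qed.

Lemma component0 K : component K (0 : A) = 0.
Proof. exact: linear0. Qed.

Lemma component_ce K H : component K (ce A H) = (H == K)%:R.
Proof.
have -> : ce A H = (cartan_tuple (ce A))`_(enum_rank H).
  by rewrite -tnth_nth tnth_mktuple enum_rankK.
rewrite /component coord_free ?(basis_free (ce_basis A))//.
by rewrite (inj_eq enum_rank_inj).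
Qed.

Lemma component_ce_sum K (k : {set 'I_n} -> R) :
  component K (\sum_H k H *: ce A H) = k K.
Proof.
rewrite /component linear_sum (bigD1 K) //= big1 => [|H HK]; rewrite -/(component _ _).
  by rewrite componentZ component_ce eqxx mulr1 addr0.
by rewrite componentZ component_ce (negbTE HK) mulr0.
Qed.

Lemma eq_component x y : (forall K, component K x = component K y) -> x = y.
Proof.
move=> xy; rewrite (component_sum x) (component_sum y).
by apply: eq_bigr => K _; rewrite xy.
Qed.

(** Left multiplication by [e_L] permutes the components up to sign; this is
    where the graph structure on the power set comes from. *)
Lemma component_mul_ce L H x :
  component (symdiff L H) (cmul A (ce A L) x) = csigma A L H * component H x.
Proof.
have -> : cmul A (ce A L) x =
    \sum_K (csigma A L (symdiff L K) * component (symdiff L K) x) *: ce A K.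
  rewrite {1}(component_sum x) linear_sumr.
  rewrite (reindex_inj (can_inj (symdiffKs _ L))) /=.
  by apply: eq_bigr => K _; rewrite linearZr_LR /= cmul_e symdiffKs scalerA mulrC.
by rewrite component_ce_sum symdiffKs.
Qed.

Lemma csigma_neq0 L H : csigma A L H != 0.
Proof. by case: (csigma_pm1 A L H) => ->; rewrite ?oppr_eq0 oner_eq0. Qed.

Lemma set0_notin_SA : ~ SA A (ce A finset.set0).
Proof.
case=> _; rewrite cmul_e csigma_l0 scale1r.
have -> : symdiff finset.set0 finset.set0 = finset.set0 :> {set 'I_n}.
  exact: symdiffss.
move=> /(congr1 (component finset.set0)).
by rewrite /cunity componentN !component_ce eqxx /=; lra.
Qed.

Lemma component_partialA K v (g : R^o * R^o -> A) z :
  component K (partialA v g z) = 'D_v (fun w => component K (g w) : R^o) z.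
Proof. exact: component_ce_sum. Qed.

(** * Dominating families are reconstructing *)

(** A component in [KK] yields the vanishing of that component of [F2] through
    the Cauchy-Riemann equations, and the vanishing of all adjacent ones through
    the relation [(e_L F2)_K = 0]. *)
Lemma dominating_reconstructing (KK : {set {set 'I_n}}) :
  SA A !=set0 ->
  (forall H, H \in KK \/ exists2 L, SA A (ce A L) & symdiff L H \in KK) ->
  reconstructing A KK.
Proof.
move=> [J SJ] dom D [[_ oD sD] cD [t Dt]] f [F [stem ind C1 CR]] cst.
(* Half the sum and half the difference of the values of [f_K] at the two points
   [p + q I] and [p - q I]. *)
have F1cst K : K \in KK -> exists c, forall I z, SA A I -> D z ->
    component K (F z).1 = c /\ component K (cmul A I (F z).2) = 0.
  move=> /cst[c fc]; exists c => I [p q] SI Dz.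
  have val w : D w -> component K (F w).1 + component K (cmul A I (F w).2) = c.
    case: w => p' q' Dw; rewrite -componentD -ind//; apply: fc.
    by exists p', q', I.
  have := val _ Dz; have := val _ (sD _ Dz).
  have [-> ->] := stem _ Dz.
  by rewrite linearNr componentN => ? ?; split; lra.
pose g1 K z : R^o := component K (F z).1.
pose g2 K z : R^o := component K (F z).2.
have CR_K K z : D z -> 'D_(1, 0) (g1 K) z = 'D_(0, 1) (g2 K) z /\
                       'D_(1, 0) (g2 K) z = - 'D_(0, 1) (g1 K) z.
  move=> /CR E.
  have /(congr1 (component K)) := congr1 fst E.
  have /(congr1 (component K)) := congr1 snd E.
  rewrite !componentD componentN !component_partialA.
  by rewrite component0 -/(g1 K) -/(g2 K) => ? ?; split; lra.
have D0 (g : R^o * R^o -> R^o) c v z : (forall w, D w -> g w = c) -> D z ->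
    'D_v g z = 0.
  move=> gc Dz; rewrite -(derive_cst c z v); apply: near_eq_derive.
  by apply: filterS (open_nbhs_nbhs (conj oD Dz)) => w /gc.
have real0 : (F (t, 0)).2 = 0.
  have [_] := stem _ Dt; rewrite /cconj /= oppr0 => E.
  by apply: eq_component => K; move: (congr1 (component K) E);
    rewrite componentN component0; lra.
have flat g : C1_real D g ->
    (forall z, D z -> 'D_(1, 0) g z = 0 /\ 'D_(0, 1) g z = 0) ->
    forall z w, D z -> D w -> g z = g w.
  move=> C1g g0; apply: zero_partials_cst => // z Dz; have [g10 g01] := g0 z Dz.
  by split; apply: DeriveDef => //;
    [case: (C1g (1, 0) (or_introl erefl) z Dz)
    |case: (C1g (0, 1) (or_intror erefl) z Dz)].
have F2_0 z : D z -> (F z).2 = 0.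
  move=> Dz; apply: eq_component => H; rewrite -real0.
  have [HK|[L SL LH]] := dom H.
    have [c gc] := F1cst H HK.
    have g1c w : D w -> g1 H w = c by move=> /(gc J w SJ)[].
    apply: (flat (g2 H)) => [|w Dw|//|//]; first by have [] := C1 H.
    have [E1 E2] := CR_K H w Dw.
    by rewrite E2 -E1 !(D0 _ _ _ _ g1c Dw) oppr0.
  have [c gc] := F1cst _ LH; have [_] := gc _ z SL Dz.
  rewrite component_mul_ce => /eqP; rewrite mulf_eq0 (negbTE (csigma_neq0 L H)) /=.
  by move=> /eqP->; rewrite real0 component0.
exists (F (t, 0)).1 => _ [p [q [I [Dz SI ->]]]].
rewrite ind// F2_0// linear0r addr0; apply: eq_component => H.
have g20 w : D w -> g2 H w = 0 by move=> Dw; rewrite /g2 F2_0// component0.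
apply: (flat (g1 H)) => [|w Dw|//|//]; first by have [] := C1 H.
have [E1 E2] := CR_K H w Dw; rewrite E1 (D0 _ _ _ _ g20 Dw); split=> //.
by apply: oppr_inj; rewrite -E2 (D0 _ _ _ _ g20 Dw) oppr0.
Qed.

(** * The bound *)

Lemma reconstructing_number_le (KK : {set {set 'I_n}}) :
  reconstructing A KK -> (reconstructing_number A <= #|KK|)%N.
Proof.
move=> rec; rewrite /reconstructing_number; case: ex_minnP => l _; apply.
by apply/asboolP; exists KK.
Qed.

Lemma dim_cartan : \dim (fullv : {vspace A}) = (2 ^ n)%N.
Proof.
by rewrite (size_basis (ce_basis A)) -cardsT -powersetT card_powerset cardsT card_ord.
Qed.

End Components.

Theorem proposition1p4 (R : realType) (n : nat) (A : cartanStarAlgebra R n)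
    (hn : (1 <= n)%N) (hA : alternative A) (hS : SA A !=set0)
    (hs : (6 <= sA A)%N) :
  (reconstructing_number A)%:R <= 127 / 418 * (\dim (fullv : {vspace A}))%:R :> R.
Proof.
have /card_gt2P[a [b [c [[aS bS cS] [ab bc ca]]]]] : (2 < sA A)%N.
  exact: leq_trans hs.
have inS K : K \in [pred K | ce A K \in SA A] -> SA A (ce A K).
  by rewrite !inE.
have nz K : K \in [pred K | ce A K \in SA A] -> K != finset.set0.
  by move=> /inS SK; apply/eqP => K0; apply: (set0_notin_SA R n A); rewrite -K0.
have [N [cardN covN]] :=
  quarter_covering n a b c (nz a aS) (nz b bS) (nz c cS) ab bc ca.
have : (reconstructing_number A <= #|N|)%N.
  apply/reconstructing_number_le/dominating_reconstructing => // H.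
  case/or4P: (covN H) => HN; [by left|right; exists a|right; exists b|
    right; exists c] => //; exact: inS.
rewrite -(ler_nat R) dim_cartan -cardN natrM.
by have : (0 : R) <= #|N|%:R by []; lra.
Qed.
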